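(* Let $1\leq m\leq n$ and let $P_m\Box P_n$ be the $m$-by-$n$ grid graph (Cartesian product of the paths on $m$ and $n$ vertices). Then: (1) if $m=1$, $\gamma_{1/2}(P_n)=\lceil n/6\rceil$; (2) if $m=2$, $\gamma_{1/2}(P_2\Box P_n)=\lceil n/4\rceil$; (3) if $m\geq 3$, $\gamma_{1/2}(P_m\Box P_n)=\lceil mn/10\rceil$.
   Context: All graphs are finite and simple; $P_k$ denotes the path on $k$ vertices and $\Box$ the Cartesian product. For a graph $G=(V,E)$ and $v\in V$, $N[v]=\{v\}\cup\{u : uv\in E\}$, and for $S\subseteq V$, $N[S]=\bigcup_{u\in S}N[u]$. For $p\in[0,1]$, a set $S\subseteq V$ is a $p$-dominating set if $|N[S]|/|V|\geq p$; the $p$-domination number $\gamma_p(G)$ is the minimum cardinality of a $p$-dominating set of $G$. *)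

(* Defs.v *)
From mathcomp Require Import all_boot all_order all_algebra.

Set Implicit Arguments.
Unset Strict Implicit.
Unset Printing Implicit Defensive.

Import Order.TTheory GRing.Theory Num.Theory.

Record sgraph := SGraph {
  vertex :> finType;
  adj : rel vertex;
  adj_sym : symmetric adj;
  adj_irrefl : irreflexive adj
}.

Section Path.
Variable k : nat.

Definition path_adj : rel 'I_k := fun i j => (i.+1 == j) || (j.+1 == i).

Lemma path_adj_sym : symmetric path_adj.
Proof. by move=> i j; rewrite /path_adj orbC. Qed.

Lemma path_adj_irrefl : irreflexive path_adj.
Proof. by move=> i; rewrite /path_adj orbb eqn_leq ltnn. Qed.

Definition path_graph : sgraph := SGraph path_adj_sym path_adj_irrefl.

End Path.

Section CartesianProduct.
Variables G H : sgraph.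

Definition cart_adj : rel (G * H)%type := fun x y =>
  (x.1 == y.1) && adj x.2 y.2 || (x.2 == y.2) && adj x.1 y.1.

Lemma cart_adj_sym : symmetric cart_adj.
Proof.
by move=> x y; rewrite /cart_adj eq_sym adj_sym [x.2 == _]eq_sym [adj x.1 _]adj_sym.
Qed.

Lemma cart_adj_irrefl : irreflexive cart_adj.
Proof. by move=> x; rewrite /cart_adj !adj_irrefl !andbF. Qed.

Definition cart_prod : sgraph := SGraph cart_adj_sym cart_adj_irrefl.

End CartesianProduct.

Section Domination.
Variable G : sgraph.

Definition closed_nbhd (v : G) : {set G} := v |: [set u | adj u v].

Definition closed_nbhds (S : {set G}) : {set G} := \bigcup_(u in S) closed_nbhd u.

Variable R : realFieldType.
Local Open Scope ring_scope.

Definition p_dominating (p : R) (S : {set G}) : bool :=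
  p <= #|closed_nbhds S|%:R / #|G|%:R.

(* For p <= 1 and G nonempty the full vertex set is p-dominating, so the
   [arg min] is a genuine minimum (see p_dom_numP); otherwise the default
   [set: G] has no meaning. *)
Definition p_dom_num (p : R) : nat :=
  #|[arg min_(S < [set: G] | p_dominating p S) #|S| ]|.

Lemma p_dominatingT (p : R) :
  p <= 1 -> (0 < #|G|)%N -> p_dominating p [set: G].
Proof.
move=> p1 G0; rewrite /p_dominating.
suff -> : closed_nbhds setT = setT.
  by rewrite cardsT divff // pnatr_eq0 -lt0n.
apply/setP=> v; rewrite inE; apply/bigcupP; exists v => //.
by rewrite in_setU1 eqxx.
Qed.

Lemma p_dom_numP (p : R) : p <= 1 -> (0 < #|G|)%N ->
  (exists2 S, p_dominating p S & #|S| = p_dom_num p) /\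
  (forall S, p_dominating p S -> (p_dom_num p <= #|S|)%N).
Proof.
move=> p1 G0; rewrite /p_dom_num.
by case: arg_minnP => [|S domS minS]; [exact: p_dominatingT | split; first exists S].
Qed.

End Domination.

(* Main.v *)
Require Import Defs.
From mathcomp Require Import all_boot all_order all_algebra.
From mathcomp Require Import zify lra.

(** A closed neighbourhood has at most 3, 4 or 5 vertices in the three cases,
    which gives the lower bounds.  For the upper bounds, gluing two grids with
    the same number of rows adds up half-dominating sets.  If the area of the
    added block is a multiple of 10 (6 for paths, 8 for two rows), the gluing
    is compatible with the rounding up, so that adding 10 columns, or 10 rows,
    reduces everything to grids with side lengths between 3 and 12.  On these a
    greedy choice of vertices is good enough, which is checked by computation. *)

(** * Half-dominating sets under embeddings and gluing of grids *)

Local Notation grid m n := (cart_prod (path_graph m) (path_graph n)).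

(** Denominators are cleared so that the condition can be checked in [nat]; [p_dominating_halfE]
    links it to [p_dominating]. *)
Definition half_dom (G : sgraph) (k : nat) : Prop :=
  exists2 S : {set G}, #|S| <= k & #|G| <= 2 * #|closed_nbhds S|.

Lemma imset_closed_nbhds {G H : sgraph} {f : G -> H} (S : {set G}) :
  {homo f : x y / adj x y} -> f @: closed_nbhds S \subset closed_nbhds (f @: S).
Proof.
move=> fadj; apply/subsetP => _ /imsetP[x /bigcupP[u uS] xu ->].
apply/bigcupP; exists (f u); first exact: imset_f.
by move: xu; rewrite !inE => /predU1P[->|/fadj ->]; rewrite ?eqxx ?orbT.
Qed.

Lemma closed_nbhdsU (G : sgraph) (S T : {set G}) :
  closed_nbhds (S :|: T) = closed_nbhds S :|: closed_nbhds T.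
Proof. exact: bigcup_setU. Qed.

(** Extra edges of [H] only enlarge neighbourhoods, so preserving adjacency in one direction is
    enough. *)
Lemma half_dom_bij (G H : sgraph) (f : G -> H) (k : nat) :
  bijective f -> {homo f : x y / adj x y} -> half_dom G k -> half_dom H k.
Proof.
move=> fbij fadj [S Sk GS]; have finj := bij_inj fbij.
exists (f @: S); first by rewrite card_imset.
rewrite -(bij_eq_card fbij) (leq_trans GS) // leq_pmul2l //.
by rewrite -(card_imset _ finj) subset_leq_card ?imset_closed_nbhds.
Qed.

(** The dominated sets of the two parts have disjoint images, so their sizes add up; edges between
    the parts can only help. *)
Lemma half_dom_glue (G1 G2 G : sgraph) (f1 : G1 -> G) (f2 : G2 -> G)
    (k1 k2 : nat) :
  injective f1 -> injective f2 -> (forall x y, f1 x != f2 y) ->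
  #|G| = #|G1| + #|G2| ->
  {homo f1 : x y / adj x y} -> {homo f2 : x y / adj x y} ->
  half_dom G1 k1 -> half_dom G2 k2 -> half_dom G (k1 + k2).
Proof.
move=> inj1 inj2 f12 cardG adj1 adj2 [S1 S1k dom1] [S2 S2k dom2].
exists (f1 @: S1 :|: f2 @: S2).
  rewrite cardsU (leq_trans (leq_subr _ _)) //.
  by rewrite leq_add // card_imset.
rewrite closed_nbhdsU cardG.
have sub := setUSS (imset_closed_nbhds S1 adj1) (imset_closed_nbhds S2 adj2).
have disj : [disjoint f1 @: closed_nbhds S1 & f2 @: closed_nbhds S2].
  rewrite -setI_eq0 -subset0; apply/subsetP => z /setIP[].
  by move=> /imsetP[x _ ->] /imsetP[y _ /eqP]; rewrite (negPf (f12 x y)).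
have := subset_leq_card sub.
have := leq_card_setU (f1 @: closed_nbhds S1) (f2 @: closed_nbhds S2).
rewrite disj => -[_ /eqP ->]; rewrite !card_imset //; lia.
Qed.

Lemma card_grid (m n : nat) : #|grid m n| = m * n.
Proof. by rewrite card_prod !card_ord. Qed.

Lemma half_dom_gridC (m n k : nat) :
  half_dom (grid m n) k -> half_dom (grid n m) k.
Proof.
apply: (@half_dom_bij (grid m n) (grid n m) (fun x => (x.2, x.1))).
  by exists (fun x => (x.2, x.1)); case.
by move=> x y; rewrite /adj /= /cart_adj /= orbC.
Qed.

Lemma half_dom_grid1 (n k : nat) :
  half_dom (grid 1 n) k -> half_dom (path_graph n) k.
Proof.
apply: (@half_dom_bij (grid 1 n) (path_graph n) snd).
  by exists (pair ord0) => // -[i j]; rewrite (ord1 i).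
move=> [i x] [j y]; rewrite /adj /= /cart_adj /= /adj /= !ord1 eqxx.
by rewrite [path_adj ord0 _]path_adj_irrefl andbF orbF.
Qed.

Lemma half_dom_grid_add (m a b k l : nat) :
  half_dom (grid m a) k -> half_dom (grid m b) l ->
  half_dom (grid m (a + b)) (k + l).
Proof.
apply: (@half_dom_glue (grid m a) (grid m b) (grid m (a + b))
  (fun x => (x.1, lshift b x.2)) (fun x => (x.1, rshift a x.2))).
- by move=> [i x] [j y] [-> /val_inj ->].
- by move=> [i x] [j y] [-> /addnI/val_inj ->].
- by move=> [i x] [j y]; rewrite xpair_eqE /= eq_lrshift andbF.
- by rewrite !card_grid mulnDr.
- by move=> [i x] [j y]; rewrite /adj /= /cart_adj /= /adj /= eq_lshift.
- move=> [i x] [j y]; rewrite /adj /= /cart_adj /= /adj /= eq_rshift.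
  by rewrite /path_adj /= -!addnS !eqn_add2l.
Qed.

(** * Rounding up and periodicity in the side length *)

Definition ceil_div (N q : nat) : nat := (N + q.-1) %/ q.

Lemma ceil_divMDl (j N q : nat) :
  0 < q -> ceil_div (j * q + N) q = j + ceil_div N q.
Proof. by move=> q0; rewrite /ceil_div -addnA divnMDl. Qed.

Lemma leq_ceil_div (N q k : nat) : 0 < q -> (ceil_div N q <= k) = (N <= k * q).
Proof. move=> q0; rewrite /ceil_div -ltnS ltn_divLR // mulSn; lia. Qed.

(** Strong induction on [n], splitting off a block of [p] columns. As [q] divides its area [m * p],
    the block contributes an integer to the quotient and rounding loses nothing. *)
Lemma half_dom_grid_period (q m p b : nat) :
  0 < q -> 0 < b <= p -> q %| m * p ->
  (forall r, b <= r < b + p -> half_dom (grid m r) (ceil_div (m * r) q)) ->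
  forall n, b <= n -> half_dom (grid m n) (ceil_div (m * n) q).
Proof.
move=> q0 /andP[b0 bp] /dvdnP[l mp] base.
elim/ltn_ind => n IH bn; have [nlt|nge] := ltnP n (b + p).
  by apply: base; rewrite bn.
have {1}-> : n = p + (n - p) by lia.
have -> : m * n = l * q + m * (n - p) by rewrite -mp; lia.
rewrite ceil_divMDl //; apply: half_dom_grid_add; last by apply: IH; lia.
(* The block is itself a base case: [0 < b <= p] puts [p] in the window from [b] to [b + p - 1]. *)
have -> : l = ceil_div (m * p) q.
  by rewrite mp -[l * q]addn0 ceil_divMDl // /ceil_div add0n divn_small ?addn0 ?prednK.
by apply: base; lia.
Qed.

(** * Greedy choices on small grids, verified by computation *)

Definition path_near (i j : nat) : bool := (i.+1 == j) || (j.+1 == i).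

Definition grid_near (u v : nat * nat) : bool :=
  (u == v) || ((u.1 == v.1) && path_near u.2 v.2
            || (u.2 == v.2) && path_near u.1 v.1).

Definition cells (m n : nat) : seq (nat * nat) :=
  [seq (i, j) | j <- iota 0 n, i <- iota 0 m].

Fixpoint argmax {T : Type} (f : T -> nat) (x : T) (s : seq T) : T :=
  if s is y :: s' then argmax f (if f x < f y then y else x) s' else x.

(* [U] is the list of cells that are not dominated yet. *)
Fixpoint greedy (C U : seq (nat * nat)) (k : nat) : seq (nat * nat) :=
  if k is k'.+1 then
    let v := argmax (fun v => count (grid_near v) U) (0, 0) C in
    v :: greedy C [seq u <- U | ~~ grid_near v u] k'
  else [::].

(** Undominated cells are counted because [card_grid_leq] transfers only upper bounds from lists to
    sets of vertices. *)
Definition half_dom_cells (m n : nat) (s : seq (nat * nat)) : bool :=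
  all (fun u => (u.1 < m) && (u.2 < n)) s &&
  (2 * count (fun v => ~~ has (grid_near^~ v) s) (cells m n) <= m * n).

Definition greedy_ok (q m n : nat) : bool :=
  let k := ceil_div (m * n) q in
  let s := greedy (cells m n) (cells m n) k in
  (size s <= k) && half_dom_cells m n s.

Lemma card_grid_leq (m n : nat) (A : {set grid m n}) (s : seq (nat * nat)) :
  (forall v, v \in A -> (val v.1, val v.2) \in s) -> #|A| <= size s.
Proof.
move=> As; pose f (v : grid m n) := (val v.1, val v.2).
have finj : injective f by move=> [i j] [i' j'] [] /val_inj -> /val_inj ->.
rewrite cardE -(size_map f); apply: uniq_leq_size.
  by rewrite map_inj_uniq ?enum_uniq.
by move=> _ /mapP[v vA ->]; apply: As; rewrite -mem_enum.
Qed.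

Lemma half_dom_cellsP (m n : nat) (s : seq (nat * nat)) :
  half_dom_cells m n s -> half_dom (grid m n) (size s).
Proof.
case/andP=> /allP s_in cnt.
pose S : {set grid m n} := [set v | (val v.1, val v.2) \in s].
exists S; first by apply: card_grid_leq => v; rewrite inE.
suff : #|~: closed_nbhds S| <=
    count (fun v => ~~ has (grid_near^~ v) s) (cells m n).
  have := cardsC (closed_nbhds S); rewrite !card_grid; lia.
rewrite -size_filter; apply: card_grid_leq => v; rewrite inE => vS.
rewrite mem_filter; apply/andP; split; last first.
  by apply/allpairsP; exists (val v.2, val v.1); rewrite /= !mem_iota !ltn_ord.
apply: contra vS => /hasP[[a b] us near]; have /andP[/= am bn] := s_in _ us.
apply/bigcupP; exists (Ordinal am, Ordinal bn); first by rewrite inE.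
rewrite !inE /adj /= /cart_adj /= /adj /= /path_adj.
case: v near => [i j]; rewrite /grid_near /path_near /= !xpair_eqE -!val_eqE /=; lia.
Qed.

Lemma greedy_half_dom (q m n : nat) :
  greedy_ok q m n -> half_dom (grid m n) (ceil_div (m * n) q).
Proof.
case/andP=> sz /half_dom_cellsP[S Sk dom].
by exists S => //; apply: leq_trans sz.
Qed.

Lemma greedy_ok1 (n : nat) : 1 <= n < 1 + 6 -> greedy_ok 6 1 n.
Proof.
rewrite -mem_iota => hn.
suff /allP : all (greedy_ok 6 1) (iota 1 6) by exact.
by vm_compute.
Qed.

Lemma greedy_ok2 (n : nat) : 1 <= n < 1 + 4 -> greedy_ok 8 2 n.
Proof.
rewrite -mem_iota => hn.
suff /allP : all (greedy_ok 8 2) (iota 1 4) by exact.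
by vm_compute.
Qed.

(** Evaluating only [m <= n] saves almost half of the computation; [half_dom_grid3] recovers the
    other pairs by transposition. *)
Lemma greedy_ok3 (m n : nat) :
  3 <= m < 3 + 10 -> 3 <= n < 3 + 10 -> m <= n -> greedy_ok 10 m n.
Proof.
rewrite -!mem_iota => hm hn; apply/implyP; move: m hm n hn.
suff /allrelP : allrel (fun m n => (m <= n) ==> greedy_ok 10 m n)
    (iota 3 10) (iota 3 10) by move=> h m hm n hn; apply: h.
by vm_compute.
Qed.

Lemma half_dom_grid3 (m n : nat) :
  3 <= m -> 3 <= n -> half_dom (grid m n) (ceil_div (m * n) 10).
Proof.
have base a b : 3 <= a < 3 + 10 -> 3 <= b < 3 + 10 ->
    half_dom (grid a b) (ceil_div (a * b) 10).
  move=> ha hb; have [ab|ba] := leqP a b.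
    exact/greedy_half_dom/greedy_ok3.
  rewrite mulnC; apply: half_dom_gridC.
  by apply/greedy_half_dom/greedy_ok3 => //; apply: ltnW.
(* Reduce the columns to the window 3 to 12, transpose, then reduce the rows in the same way. *)
move=> hm hn; move: n hn.
apply: (@half_dom_grid_period 10 m 10 3) => // [|b hb]; first exact: dvdn_mull.
rewrite mulnC; apply: half_dom_gridC; move: m hm.
apply: (@half_dom_grid_period 10 b 10 3) => // [|a ha]; first exact: dvdn_mull.
exact: base.
Qed.

(** * Degree bounds and the size of closed neighbourhoods *)

Definition deg_le (G : sgraph) (d : nat) : Prop :=
  forall v : G, #|[set u | adj u v]| <= d.

(** Serves for [path_graph 2], where it gives 1 instead of the bound 2 of [deg_le_path]. *)
Lemma deg_le_pred (G : sgraph) : deg_le G #|G|.-1.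
Proof.
move=> v; rewrite -(cardsC1 v); apply: subset_leq_card; apply/subsetP => u.
by rewrite !inE; apply: contraTneq => ->; rewrite adj_irrefl.
Qed.

Lemma deg_le_path (k : nat) : deg_le (path_graph k) 2.
Proof.
move=> v; rewrite cardE -(size_map val).
(* The list need only contain the neighbours: at an end of the path one of its entries is not a
   neighbour. *)
apply: (@uniq_leq_size _ _ [:: v.-1; v.+1]).
  by rewrite map_inj_uniq ?enum_uniq //; exact: val_inj.
move=> _ /mapP[u + ->]; rewrite mem_enum !inE /adj /= /path_adj; lia.
Qed.

Lemma deg_le_cart (G H : sgraph) (d e : nat) :
  deg_le G d -> deg_le H e -> deg_le (cart_prod G H) (d + e).
Proof.
move=> dG dH v; apply: leq_trans (leq_add (dG v.1) (dH v.2)).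
apply: leq_trans (_ : #|setX [set u | adj u v.1] [set v.2] :|:
                         setX [set v.1] [set u | adj u v.2]| <= _); last first.
  by rewrite cardsU !cardsX !cards1 muln1 mul1n leq_subr.
apply: subset_leq_card; apply/subsetP => u; rewrite !inE {1}/adj /= /cart_adj.
by rewrite orbC andbC.
Qed.

Lemma card_closed_nbhds (G : sgraph) (d : nat) (S : {set G}) :
  deg_le G d -> #|closed_nbhds S| <= #|S| * d.+1.
Proof.
move=> dG; rewrite -sum_nat_const.
apply: leq_trans (_ : \sum_(u in S) #|closed_nbhd u| <= _).
  elim/big_rec2: (closed_nbhds S) => [|u k A _ IH]; first by rewrite cards0.
  by rewrite (leq_trans (leq_card_setU _ _)) // leq_add2l.
apply: leq_sum => u _; rewrite (leq_trans (leq_card_setU _ _)) //.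
by rewrite cards1 add1n ltnS.
Qed.

(** * The half-domination number as a ceiling *)

Import Order.TTheory GRing.Theory Num.Theory.
Local Open Scope ring_scope.

Lemma p_dominating_halfE (R : realFieldType) (G : sgraph) (S : {set G}) :
  (0 < #|G|)%N ->
  p_dominating (1 / 2 : R) S = (#|G| <= 2 * #|closed_nbhds S|)%N.
Proof.
move=> G0; rewrite /p_dominating ler_pdivlMr ?ltr0n //.
rewrite -(ler_nat R) natrM; apply/idP/idP; lra.
Qed.

Lemma p_dom_num_half (R : realFieldType) (G : sgraph) (d : nat) :
  (0 < #|G|)%N -> deg_le G d -> half_dom G (ceil_div #|G| (2 * d.+1)) ->
  p_dom_num G (1 / 2 : R) = ceil_div #|G| (2 * d.+1).
Proof.
move=> G0 dG [T Tk domT]; have p1 : 1 / 2 <= 1 :> R by lra.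
have [[S domS <-] minS] := p_dom_numP p1 G0.
apply/eqP; rewrite eqn_leq; apply/andP; split.
  by apply: leq_trans Tk; rewrite minS ?p_dominating_halfE.
(* Lower bound: each chosen vertex dominates at most [d.+1] vertices, so
   [#|G| <= 2 * d.+1 * #|S|]. *)
rewrite leq_ceil_div //; move: domS; rewrite p_dominating_halfE // => domS.
have := card_closed_nbhds _ _ S dG; lia.
Qed.

Lemma ceil_divE (R : archiRealFieldType) (N q : nat) :
  (0 < q)%N -> (ceil_div N q)%:Z = Num.ceil (N%:R / q%:R : R).
Proof.
move=> q0; apply/eqP; rewrite eq_sym ceil_eq.
rewrite ltr_pdivlMr ?ler_pdivrMr ?ltr0n // !pmulrn -!intrM ltr_int ler_int.
have := leq_ceil_div N q (ceil_div N q) q0.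
have := leq_ceil_div N q (ceil_div N q).-1 q0.
(* The value 0 is separate: its predecessor is 0 in [nat] but -1 in the integers. *)
case: (ceil_div N q) => [|k] /=; nia.
Qed.

Theorem theorem2p8 (R : archiRealFieldType) (m n : nat)
    (hm : (1 <= m)%N) (hmn : (m <= n)%N) :
  [/\ m = 1%N ->
        (p_dom_num (path_graph n) (1 / 2 : R))%:Z = Num.ceil (n%:R / 6 : R),
      m = 2%N ->
        (p_dom_num (cart_prod (path_graph 2) (path_graph n)) (1 / 2 : R))%:Z
          = Num.ceil (n%:R / 4 : R)
    & (3 <= m)%N ->
        (p_dom_num (cart_prod (path_graph m) (path_graph n)) (1 / 2 : R))%:Z
          = Num.ceil ((m * n)%:R / 10 : R)].
Proof.
have n0 : (0 < n)%N by apply: leq_trans hmn.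
split=> [_|_|m3].
- rewrite (@p_dom_num_half R _ 2) ?card_ord //; first exact: ceil_divE.
    exact: deg_le_path.
  (* The path is treated as a grid with a single row. *)
  apply: half_dom_grid1; rewrite -[n in ceil_div n]mul1n.
  apply: (@half_dom_grid_period 6 1 6 1) => // r hr.
  exact/greedy_half_dom/greedy_ok1.
- rewrite (@p_dom_num_half R _ 3) ?card_grid ?muln_gt0 //.
  (* Degree 3 gives the quotient [2 * n / 8], which is [n / 4]. *)
  + rewrite (ceil_divE R) //; congr Num.ceil; rewrite natrM; lra.
  + have := deg_le_cart _ _ _ _ (deg_le_pred (path_graph 2)) (deg_le_path n).
    by rewrite card_ord.
  apply: (@half_dom_grid_period 8 2 4 1) => // r hr.
  exact/greedy_half_dom/greedy_ok2.
- rewrite (@p_dom_num_half R _ 4) ?card_grid ?muln_gt0 ?hm //.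
  + exact: ceil_divE.
  + exact: (deg_le_cart _ _ _ _ (deg_le_path m) (deg_le_path n)).
  by apply: half_dom_grid3 => //; apply: leq_trans hmn.
Qed.
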